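(* For every $\epsilon \in (0, 1/4]$ there exist weighted undirected graphs $G_1$ and $G_2$, with spectral densities $p_1$ and $p_2$ respectively, such that: (i) $W_1(p_1,p_2) \geq \epsilon$; and (ii) for every positive integer $j$, $(1-\delta)\, m_j(p_1) \leq m_j(p_2) \leq (1+\delta)\, m_j(p_1)$ for some $\delta \leq 16\cdot 2^{-1/(4\epsilon)}$, where $m_j(p) = \int_{-1}^1 x^j p(x)\,dx$.
   Context: For a weighted undirected graph $G$ on $N$ vertices (edge weights nonnegative, self-loops allowed), let $\tilde A$ be its weighted adjacency matrix ($\tilde A(v,v')$ is the weight of edge $\{v,v'\}$, $\tilde A(v,v)$ the weight of the self-loop at $v$, $0$ if absent), $D$ the diagonal matrix of row sums of $\tilde A$, and $A(G) = D^{-1/2}\tilde A D^{-1/2}$ the normalized adjacency matrix, whose eigenvalues $\lambda_1\le\dots\le\lambda_N$ lie in $[-1,1]$. The spectral density of $G$ is the probability distribution $p = \frac{1}{N}\sum_{i=1}^N \delta_{\lambda_i}$ on $[-1,1]$; its $j$-th moment is $m_j(p)=\frac1N\sum_i \lambda_i^j = \frac1N \mathrm{tr}(A(G)^j)$. $W_1$ denotes the Wasserstein-1 distance between distributions on $\mathbb R$: the minimum over couplings $\psi$ of $p_1,p_2$ of $\int\int |x-y|\,d\psi(x,y)$. *)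

(* Defs.v *)
From HB Require Import structures.
From mathcomp Require Import all_boot all_order all_algebra.
From mathcomp Require Import all_classical all_reals all_analysis.

Set Implicit Arguments.
Unset Strict Implicit.
Unset Printing Implicit Defensive.

Import Order.TTheory GRing.Theory Num.Theory.

Local Open Scope classical_set_scope.
Local Open Scope ring_scope.

(* A zero weight means that the edge is absent. The row sums are required to be
   positive because the normalized adjacency matrix uses D^(-1/2). *)
Record weighted_graph (R : realType) := WeightedGraph {
  nverts : nat;
  weight : 'M[R]_nverts;
  nverts_gt0 : (0 < nverts)%N;
  weight_sym : forall v w, weight v w = weight w v;
  weight_ge0 : forall v w, 0 <= weight v w;
  degree_gt0 : forall v, 0 < \sum_w weight v w }.

Definition degree (R : realType) (G : weighted_graph R) (v : 'I_(nverts G)) : R :=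
  \sum_w weight G v w.

Definition normalized_adjacency (R : realType) (G : weighted_graph R) :
    'M[R]_(nverts G) :=
  let Dm12 := diag_mx (\row_v (Num.sqrt (degree v))^-1) in
  Dm12 *m weight G *m Dm12.

(* The eigenvalues are listed with their multiplicities as roots of the
   characteristic polynomial. *)
Definition eigenvalues (R : realType) (n : nat) (A : 'M[R]_n)
    (lam : n.-tuple R) : Prop :=
  sorted <=%R lam /\ char_poly A = \prod_(x <- lam) ('X - x%:P).

Definition spectral_density (R : realType) (G : weighted_graph R)
    (p : probability R R) : Prop :=
  exists2 lam : (nverts G).-tuple R,
    eigenvalues (normalized_adjacency G) lam &
    forall U : set R, measurable U ->
      p U = (((nverts G)%:R^-1)%:E * \sum_(x <- lam) \d_x U)%E.

Definition moment (R : realType) (j : nat) (p : probability R R) : R :=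
  \int[p]_(x in `[-1, 1]) x ^+ j.

Definition coupling (R : realType) (p1 p2 : probability R R)
    (psi : probability (R * R)%type R) : Prop :=
  forall U : set R, measurable U ->
    pushforward psi fst U = p1 U /\ pushforward psi snd U = p2 U.

Definition wasserstein1 (R : realType) (p1 p2 : probability R R) : \bar R :=
  ereal_inf [set (\int[psi]_z `|z.1 - z.2|%:E)%E | psi in coupling p1 p2].

(* Main.v *)
From HB Require Import structures.
Require Import Defs.
From mathcomp Require Import all_boot all_order all_algebra.
From mathcomp Require Import all_classical all_reals all_analysis.
From mathcomp Require Import measurable_realfun ring lra.
Import Order.TTheory GRing.Theory Num.Theory.
Local Open Scope classical_set_scope.
Local Open Scope ring_scope.

(** A disjoint union of two-vertex graphs realizes any spectral density
    (delta_1 + q) / 2 with q uniform on a multiset of points of [-1, 1].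
    Let n be the integer part of 1 / (4 eps), and let q1 (resp. q2) put mass
    proportional to 'C(n, k) on k / (2n) for the even (resp. odd) k <= n.
    Their moments of order j < n agree because the n-th finite difference kills
    polynomials of degree less than n; for j >= n they lie in [0, 2^-n], which
    is a relative error of at most 2^-n thanks to the atom at 1.  Half of the
    mass of p2 sits at odd points, all at distance at least 1 / (2n) from the
    support of p1, so W1 is at least 1 / (4n) >= eps. *)

(** * Binomial multisets and their power sums *)

(* [binomial_even n] and [binomial_odd n] contain each k <= n of the given
   parity with multiplicity 'C(n, k). *)
Fixpoint binomial_split (n : nat) : seq nat * seq nat :=
  if n is m.+1 then
    let: (ev, od) := binomial_split m in (ev ++ map S od, od ++ map S ev)
  else ([:: 0%N], [::]).

Definition binomial_even n := (binomial_split n).1.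
Definition binomial_odd n := (binomial_split n).2.

Lemma binomial_evenS n :
  binomial_even n.+1 = binomial_even n ++ map S (binomial_odd n).
Proof. by rewrite /binomial_even /binomial_odd /=; case: binomial_split. Qed.

Lemma binomial_oddS n :
  binomial_odd n.+1 = binomial_odd n ++ map S (binomial_even n).
Proof. by rewrite /binomial_even /binomial_odd /=; case: binomial_split. Qed.

Lemma mem_binomial_split n k :
  (k \in binomial_even n -> ~~ odd k && (k <= n)%N) /\
  (k \in binomial_odd n -> odd k && (k <= n)%N).
Proof.
elim: n k => [|n IHn] k; first by split=> //; rewrite inE => /eqP ->.
rewrite binomial_evenS binomial_oddS !mem_cat; have [kE kO] := IHn k.
split=> /orP[].
- by move=> /kE /andP[-> /leqW ->].
- by case/mapP=> i /(IHn i).2 /andP[oi le_in] ->; rewrite /= oi ltnS le_in.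
- by move=> /kO /andP[-> /leqW ->].
- by case/mapP=> i /(IHn i).1 /andP[oi le_in] ->; rewrite /= oi ltnS le_in.
Qed.

(** Both lists at [n.+1] collect the two lists at [n]. Equal sizes give the two averages the same
    normalization; at [n = 0] the odd list is empty. *)
Lemma size_binomial_split n : (0 < n)%N ->
  size (binomial_odd n) = size (binomial_even n) /\
  (0 < size (binomial_even n))%N.
Proof.
case: n => // n _.
rewrite binomial_evenS binomial_oddS !size_cat !size_map addnC; split=> //.
rewrite addn_gt0; apply/orP; left.
by elim: n => // n; rewrite binomial_evenS size_cat addn_gt0 => ->.
Qed.

(** Expanding the shifted powers, both sides at [n.+1] contain the even and the odd power sum of
    order [j] at [n]. These cancel even for [j = n], where the induction hypothesis says nothing;
    only orders below [j] remain. *)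
Lemma binomial_power_sums (R : comPzRingType) n j : (j < n)%N ->
  \sum_(k <- binomial_even n) k%:R ^+ j =
  \sum_(k <- binomial_odd n) k%:R ^+ j :> R.
Proof.
elim: n j => // n IHn j lt_jn.
have shiftE s : \sum_(k <- map S s) (k%:R : R) ^+ j =
    \sum_(k <- s) k%:R ^+ j
    + \sum_(i < j) (\sum_(k <- s) (k%:R : R) ^+ i) *+ 'C(j, i).
  rewrite big_map.
  under eq_bigr => k _.
    (* The top term of the binomial expansion is split off, leaving only orders below [j] under the
       sum. *)
    rewrite -add1n natrD exprDn big_ord_recr /= subnn mul1r binn mulr1n addrC.
    under eq_bigr do rewrite expr1n mul1r.
    over.
  rewrite big_split /= exchange_big /=; congr (_ + _).
  by apply: eq_bigr => i _; rewrite sumrMnl.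
rewrite binomial_evenS binomial_oddS !big_cat /= !shiftE addrCA.
congr (_ + (_ + _)); apply: eq_bigr => i _.
by rewrite IHn// (leq_trans (ltn_ord i)).
Qed.

(** * Graphs with prescribed eigenvalues *)

Lemma det_block_sym (R : comNzRingType) n (A B : 'M[R]_n) :
  \det (block_mx A B B A) = \det (A + B) * \det (A - B).
Proof.
(* Adding the second block row to the first, then subtracting the first block column from the
   second, gives a lower triangular matrix with diagonal blocks [A + B] and [A - B]. Both
   multipliers have determinant 1. *)
have := congr1 determinant (mulmx_block 1%:M 1%:M 0 1%:M A B B A).
have := congr1 determinant
  (mulmx_block (A + B) (A + B) B A 1%:M (- 1%:M) 0 1%:M).
rewrite !mul1mx !mul0mx !mulmxN !mulmx0 !mulmx1 !add0r !addr0 addNr.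
rewrite [- B + A]addrC [B + A]addrC det_lblock !det_mulmx !det_ublock !det1.
by rewrite !mulr1 => ->; rewrite mul1r.
Qed.

(* Each eigenvalue mu is realized by a two-vertex component with loops of
   weight (1 + mu) / 2 and an edge of weight (1 - mu) / 2. *)
Section PairGraph.
Variables (R : realType) (mu : seq R).
Hypothesis mu_gt0 : (0 < size mu)%N.
Hypothesis mu_bound : forall x, x \in mu -> -1 <= x <= 1.

Let n := size mu.
Let loops : 'rV[R]_n := \row_i ((1 + mu`_i) / 2).
Let edges : 'rV[R]_n := \row_i ((1 - mu`_i) / 2).
Let W : 'M[R]_(n + n) :=
  block_mx (diag_mx loops) (diag_mx edges) (diag_mx edges) (diag_mx loops).

Let nth_bound (i : 'I_n) : -1 <= mu`_i <= 1.
Proof. by apply: mu_bound; rewrite mem_nth. Qed.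

Let tr_W : W^T = W.
Proof. by rewrite tr_block_mx !tr_diag_mx. Qed.

Let W_sym v w : W v w = W w v.
Proof. by rewrite -[in LHS]tr_W mxE. Qed.

Let diag_ge0 (d : 'rV[R]_n) : (forall i, 0 <= d 0 i) ->
  forall i j, 0 <= diag_mx d i j.
Proof. by move=> d0 i j; rewrite mxE mulrn_wge0. Qed.

Let W_ge0 v w : 0 <= W v w.
Proof.
have l0 i : 0 <= loops 0 i.
  by rewrite mxE divr_ge0// -lerBlDl sub0r; case/andP: (nth_bound i).
have e0 i : 0 <= edges 0 i.
  by rewrite mxE divr_ge0// subr_ge0; case/andP: (nth_bound i).
rewrite -[v]splitK -[w]splitK; case: (fintype.split v) => i; case: (fintype.split w) => j /=;
  by rewrite ?(block_mxEul, block_mxEur, block_mxEdl, block_mxEdr) diag_ge0.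
Qed.

Let sum_diag (d : 'rV[R]_n) i : \sum_j diag_mx d i j = d 0 i.
Proof.
rewrite (bigD1 i) //= big1 ?addr0 ?mxE ?eqxx// => j ji.
by rewrite mxE eq_sym (negPf ji).
Qed.

(** Unit degrees make the normalization trivial: the normalized adjacency matrix is [W] itself. *)
Let W_row v : \sum_w W v w = 1.
Proof.
have le i : loops 0 i + edges 0 i = 1.
  by rewrite !mxE -mulrDl addrACA subrr addr0 divff.
rewrite big_split_ord /= -[v]splitK; case: (fintype.split v) => i /=.
  under eq_bigr do rewrite block_mxEul.
  under [X in _ + X]eq_bigr do rewrite block_mxEur.
  by rewrite !sum_diag.
under eq_bigr do rewrite block_mxEdl.
under [X in _ + X]eq_bigr do rewrite block_mxEdr.
by rewrite !sum_diag addrC.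
Qed.

Let W_deg v : 0 < \sum_w W v w.
Proof. by rewrite W_row. Qed.

Let nn_gt0 : (0 < n + n)%N.
Proof. by rewrite addn_gt0 mu_gt0. Qed.

Definition pair_graph : weighted_graph R :=
  WeightedGraph nn_gt0 W_sym W_ge0 W_deg.

(** The characteristic matrix has the symmetric block form of [det_block_sym]. Its two factors are
    the characteristic polynomials of loops plus edges, which is the identity, and of loops minus
    edges, which is diagonal with entries [mu]. *)
Lemma pair_graph_eigenvalues :
  exists2 lam : (nverts pair_graph).-tuple R,
    eigenvalues (normalized_adjacency pair_graph) lam &
    perm_eq lam (nseq (size mu) 1 ++ mu).
Proof.
have NW : normalized_adjacency pair_graph = W.
  rewrite /normalized_adjacency /degree /=.
  rewrite [\row__ _](_ : _ = const_mx 1) ?diag_const_mx ?mul1mx ?mulmx1//.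
  by apply/rowP => v; rewrite !mxE W_row sqrtr1 invr1.
have size_s : size (sort <=%R (nseq (size mu) 1 ++ mu)) == nverts pair_graph.
  by rewrite size_sort size_cat size_nseq.
exists (Tuple size_s); last by rewrite /= perm_sort.
split; first by apply: sort_sorted; exact: le_total.
rewrite NW /= (perm_big _ (permEl (perm_sort _ _))) big_cat /=.
rewrite /char_poly /char_poly_mx map_block_mx !map_diag_mx scalar_mx_block.
rewrite opp_block_mx add_block_mx !add0r det_block_sym.
rewrite -!diag_const_mx -!linearN -!linearD /= !det_diag; congr (_ * _).
  rewrite big_nseq -[in RHS](card_ord (size mu)) -big_const.
  apply: eq_bigr => i _; rewrite !mxE.
  rewrite -addrA -opprD -polyCD; congr ('X - _%:P).
  by rewrite -mulrDl addrACA subrr addr0 divff.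
rewrite (big_nth 0) big_mkord; apply: eq_bigr => i _; rewrite !mxE.
rewrite -addrA -opprD -polyCB; congr (_ - _%:P); by field.
Qed.
End PairGraph.

(** * Empirical measures: moments and transport cost *)

Definition empirical (R : realType) (s : seq R) (p : set R -> \bar R) : Prop :=
  forall U : set R, measurable U ->
    p U = (((size s)%:R^-1)%:E * \sum_(x <- s) \d_x U)%E.

Lemma empirical_perm (R : realType) (s t : seq R) (p : set R -> \bar R) :
  perm_eq s t -> empirical R s p -> empirical R t p.
Proof.
by move=> st sp U mU; rewrite sp// (perm_size st) (perm_big _ st).
Qed.

Section EmpiricalMeasure.
Variables (R : realType) (s : seq R).

Let size_inv : {nonneg R} := NngNum (eqbRL (invr_ge0 _) (ler0n R (size s))).

(** Assembled from scaling, sums and Dirac masses so that the measure structure is inherited and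
    integrals unfold one atom at a time. *)
Definition empirical_measure : set R -> \bar R :=
  mscale size_inv (msum (fun i => \d_(s`_i)) (size s)).

HB.instance Definition _ := Measure.on empirical_measure.

Lemma empirical_measureP : empirical R s empirical_measure.
Proof.
move=> U mU; rewrite /empirical_measure /mscale /msum.
by rewrite (big_nth 0) big_mkord.
Qed.

Lemma ge0_integral_empirical_measure (D : set R) (f : R -> \bar R) :
  measurable D -> measurable_fun D f -> (forall x, D x -> 0 <= f x)%E ->
  (\int[empirical_measure]_(x in D) f x =
   ((size s)%:R^-1)%:E * \sum_(x <- s) \d_x D * f x)%E.
Proof.
move=> mD mf f0.
rewrite ge0_integral_mscale// ge0_integral_measure_sum// (big_nth 0) big_mkord.
by congr (_ * _)%E; apply: eq_bigr => i _; rewrite integral_dirac.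
Qed.
End EmpiricalMeasure.

Lemma empirical_probability_exists (R : realType) (s : seq R) :
  (0 < size s)%N -> exists p : probability R R, empirical R s p.
Proof.
move=> s0.
have T1 : empirical_measure R s [set: R] = 1%E.
  rewrite empirical_measureP//; under eq_bigr do rewrite diracT.
  rewrite sumEFin -EFinM big_tnth sumr_const card_ord /= mulVf//.
  by rewrite pnatr_eq0 -lt0n.
pose B := Measure_isProbability.Build _ _ _ (empirical_measure R s) T1.
pose p : probability R R := HB.pack (empirical_measure R s) B.
by exists p; exact: empirical_measureP.
Qed.

Lemma moment_empirical (R : realType) (s : seq R) (p : probability R R) j :
  (forall x, x \in s -> 0 <= x <= 1) -> empirical R s p ->
  moment j p = (size s)%:R^-1 * \sum_(x <- s) x ^+ j.
Proof.
move=> s01 ep; rewrite /moment /Rintegral.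
have mD : measurable (`[-1, 1] : set R) by exact: measurable_itv.
have mX : measurable_fun (`[-1, 1] : set R) (fun x : R => (x ^+ j)%:E).
  by apply/measurable_EFinP; exact: measurable_funX.
rewrite (eq_measure_integral (empirical_measure R s)); last first.
  by move=> A mA _; exact: etrans (ep A mA) (esym (empirical_measureP _ _ _ mA)).
(* For odd [j] the integrand is negative on part of the interval, so positive and negative parts are
   treated separately; the negative part vanishes at every atom. *)
rewrite integralE !ge0_integral_empirical_measure//; last 2 first.
- exact: measurable_funeneg.
- exact: measurable_funepos.
rewrite [X in (_ - _ * X)%E]big1_seq; last first.
  move=> x /andP[_ /s01 /andP[x0 _]].
  by rewrite funenegE/= max_r ?mule0// lee_fin oppr_le0 exprn_ge0.
rewrite mule0 sube0 (eq_big_seq (fun x => (x ^+ j)%:E)).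
  by rewrite sumEFin -EFinM.
move=> x /s01 /andP[x0 x1].
rewrite funeposE/= max_l ?lee_fin ?exprn_ge0// diracE mem_set ?mul1e//.
by rewrite /= in_itv/= x1 andbT (le_trans _ x0)// oppr_le0.
Qed.

(** Under any coupling the first coordinate almost surely lies in [A], so all the mass that [p2]
    gives to [B] has travelled at least [r]. *)
Lemma wasserstein1_ge (R : realType) (p1 p2 : probability R R) (A B : set R)
    (r : R) : measurable A -> measurable B -> 0 <= r -> p1 (~` A) = 0%E ->
  (forall x y, A x -> B y -> r <= `|x - y|) ->
  (r%:E * p2 B <= wasserstein1 p1 p2)%E.
Proof.
move=> mA mB r0 pA AB; apply: le_ereal_inf_tmp => _ [psi cpsi <-].
have mAB : measurable (A `*` B) by exact: measurableX.
have md : measurable_fun [set: R * R] (fun z : R * R => `|z.1 - z.2|%:E).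
  apply/measurable_EFinP; apply: measurableT_comp => //.
  exact: measurable_funB.
apply: (@le_trans _ _ (\int[psi]_(z in A `*` B) `|z.1 - z.2|%:E)%E);
  last exact: ge0_subset_integral.
apply: (@le_trans _ _ (\int[psi]_(z in A `*` B) cst r%:E z)%E); last first.
  apply: ge0_le_integral => //; first exact: measurable_funTS.
  by move=> [x y] [Ax By] /=; rewrite lee_fin AB.
(* The added zero becomes the mass of the null event that the first coordinate misses [A]; together
   with the product of [A] and [B], this event covers the preimage of [B]. *)
rewrite integral_cst// lee_wpmul2l// -[leRHS]adde0.
have mB' : measurable ((snd : R * R -> R) @^-1` B).
  by rewrite -[_ @^-1` _]setTI; exact: measurable_snd.
have mA' : measurable ((fst : R * R -> R) @^-1` (~` A)).
  by rewrite -[_ @^-1` _]setTI; apply: measurable_fst => //; exact: measurableC.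
have [_ <-] := cpsi B mB.
have <- : pushforward psi fst (~` A) = 0%E.
  by have [-> _] := cpsi _ (measurableC mA).
rewrite /pushforward; apply: (le_trans _ (measureU2 _ mAB mA')).
apply: le_measure; rewrite ?inE//; first exact: measurableU.
move=> [x y] /= By; have [Ax|nAx] := pselect (A x); [by left|by right].
Qed.

(** * Spectral densities with half of their mass at 1 *)

Lemma pair_graph_spectral_density (R : realType) (mu : seq R) :
  (0 < size mu)%N -> (forall x, x \in mu -> -1 <= x <= 1) ->
  exists (G : weighted_graph R) (p : probability R R),
    spectral_density G p /\ empirical R (nseq (size mu) 1 ++ mu) p.
Proof.
move=> mu0 mub; pose G := pair_graph R mu mu0 mub.
have [lam lamE lam_perm] := pair_graph_eigenvalues R mu mu0 mub.
have [] := @empirical_probability_exists R lam.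
  by rewrite size_tuple; exact: nverts_gt0.
move=> p lamp; exists G, p; split; last exact: empirical_perm lamp.
by exists lam => // U mU; rewrite lamp// size_tuple.
Qed.

Lemma moment_pair (R : realType) (mu : seq R) (p : probability R R) j :
  (0 < size mu)%N -> (forall x, x \in mu -> 0 <= x <= 1) ->
  empirical R (nseq (size mu) 1 ++ mu) p ->
  moment j p = (1 + (size mu)%:R^-1 * \sum_(x <- mu) x ^+ j) / 2.
Proof.
move=> mu0 mub ep; rewrite (moment_empirical _ _ _ _ _ ep); last first.
  move=> x; rewrite mem_cat => /orP[|/mub//].
  by rewrite mem_nseq => /andP[_ /eqP ->]; rewrite ler01 lexx.
have m0 : (size mu)%:R != 0 :> R by rewrite pnatr_eq0 -lt0n.
rewrite size_cat size_nseq big_cat /= big_nseq iter_addr_0 expr1n natrD.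
set S := \sum_(_ <- _) _; rewrite -mulr2n -mulr_natr.
by field.
Qed.

Lemma measurable_seq (R : realType) (s : seq R) :
  measurable ([set` s] : set R).
Proof.
apply: countable_measurable => [x|]; first exact: measurable_set1.
exact/finite_set_countable/finite_seq.
Qed.

(** [wasserstein1_ge] applies with the support of [p1] and the points of [nu]. The latter carry at
    least half of the mass of [p2], hence the factor 1/2. *)
Lemma wasserstein1_pair_ge (R : realType) (mu nu : seq R)
    (p1 p2 : probability R R) (r : R) : (0 < size nu)%N -> 0 <= r ->
  empirical R (nseq (size mu) 1 ++ mu) p1 ->
  empirical R (nseq (size nu) 1 ++ nu) p2 ->
  (forall x y, x = 1 \/ x \in mu -> y \in nu -> r <= `|x - y|) ->
  ((r / 2)%:E <= wasserstein1 p1 p2)%E.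
Proof.
move=> nu0 r0 ep1 ep2 far.
set s := nseq (size mu) 1 ++ mu in ep1 *.
have pA : p1 (~` [set` s]) = 0%E.
  rewrite ep1; last by apply: measurableC; exact: measurable_seq.
  rewrite big1_seq ?mule0// => x /andP[_ xs].
  by rewrite diracE memNset//=; apply.
have far' x y : [set` s] x -> [set` nu] y -> r <= `|x - y|.
  move=> /= xs; apply: far; move: xs; rewrite /s mem_cat mem_nseq.
  by case/orP=> [/andP[_ /eqP]|]; [left|right].
apply: le_trans (wasserstein1_ge R p1 p2 _ _ r (measurable_seq _ s)
  (measurable_seq _ nu) r0 pA far').
rewrite EFinM lee_wpmul2l ?lee_fin// ep2; last exact: measurable_seq.
rewrite big_cat /= [X in (_ + X)%E](eq_big_seq (fun=> 1%E)); last first.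
  by move=> x xnu; rewrite diracE mem_set.
have n0 : (0 < (size nu)%:R :> R) by rewrite ltr0n.
have -> : (2^-1)%:E = (((size nu + size nu)%:R^-1 : R)%:E * (size nu)%:R%:E)%E.
  rewrite -EFinM natrD; congr (_%:E).
  by rewrite -mulr2n -[(size nu)%:R *+ 2]mulr_natl invfM mulfVK ?gt_eqF.
rewrite size_cat size_nseq lee_wpmul2l ?lee_fin ?invr_ge0//.
have -> : (\sum_(x <- nu) 1 = (size nu)%:R%:E :> \bar R)%E.
  by rewrite sumEFin big_const_seq count_predT iter_addr_0.
by rewrite leeDr//; apply: sume_ge0 => x _; exact: measure_ge0.
Qed.

(** * Choice of parameters and verification *)

Theorem theorem2 (R : realType) (eps : R) (heps : 0 < eps <= 1 / 4) :
  exists (G1 G2 : weighted_graph R) (p1 p2 : probability R R),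
    [/\ spectral_density G1 p1,
        spectral_density G2 p2,
        (eps%:E <= wasserstein1 p1 p2)%E &
        exists2 delta : R, delta <= 16 * 2 `^ (- (1 / (4 * eps))) &
          forall j : nat, (0 < j)%N ->
            (1 - delta) * moment j p1 <= moment j p2
              <= (1 + delta) * moment j p1].
Proof.
case/andP: heps => eps0 eps4.
pose n := Num.trunc (1 / (4 * eps)).
have e0 : 0 < 4 * eps by rewrite mulr_gt0.
have /truncn_itv/andP[n_le n_gt] : 0 <= 1 / (4 * eps) by rewrite divr_ge0 ?ltW.
rewrite -/n in n_le n_gt.
have n0 : (0 < n)%N by rewrite truncn_gt0 ler_pdivlMr// mul1r; lra.
have n0R : 1 <= n%:R :> R by rewrite ler1n.
have [size_odd size_even0] := size_binomial_split n n0.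
(* Dividing by [2 * n] places the points in [0, 1/2]: their [j]-th powers are at most [2 ^- j], and
   they stay at distance at least 1/2 from the atom at 1. *)
pose pt (k : nat) : R := k%:R / (2 * n%:R).
pose mu := map pt (binomial_even n); pose nu := map pt (binomial_odd n).
have size_nu : size nu = size mu by rewrite !size_map.
have mu0 : (0 < size mu)%N by rewrite size_map.
have nu0 : (0 < size nu)%N by rewrite size_nu.
have pt_bound k : (k <= n)%N -> 0 <= pt k <= 1 / 2.
  move=> kn; rewrite divr_ge0 ?mulr_ge0//= ler_pdivrMr ?mulr_gt0 ?ltr0n//.
  by rewrite mulrA divfK ?mul1r ?ler_nat// pnatr_eq0.
have mu_bound x : x \in mu -> 0 <= x <= 1 / 2.
  by case/mapP=> k /(mem_binomial_split n k).1 /andP[_ /pt_bound kb] ->.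
have nu_bound x : x \in nu -> 0 <= x <= 1 / 2.
  by case/mapP=> k /(mem_binomial_split n k).2 /andP[_ /pt_bound kb] ->.
have [||G1 [p1 [Gp1 ep1]]] := @pair_graph_spectral_density R mu; first by [].
  by move=> x /mu_bound; lra.
have [||G2 [p2 [Gp2 ep2]]] := @pair_graph_spectral_density R nu; first by [].
  by move=> x /nu_bound; lra.
exists G1, G2, p1, p2; split=> //.
  (* The spacing of consecutive grid points; half of it is at least [eps] because [n] is at most
     [1 / (4 * eps)]. *)
  pose r : R := 1 / (2 * n%:R).
  have r0 : 0 <= r by rewrite divr_ge0 ?mulr_ge0.
  have far k l : (k < l)%N -> r <= pt l - pt k.
    move=> kl; rewrite -mulrBl ler_pM2r ?invr_gt0 ?mulr_gt0 ?ltr0n//.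
    by rewrite lerBrDl natr1 ler_nat.
  apply: le_trans (wasserstein1_pair_ge R mu nu p1 p2 r nu0 r0 ep1 ep2 _).
    move: n_le; rewrite lee_fin /r !ler_pdivlMr ?mulr_gt0 ?ltr0n//; lra.
  move=> x y [->|/mapP[k /(mem_binomial_split n k).1 /andP[ok _] ->]].
    move=> /nu_bound yb; rewrite ger0_norm; last by lra.
    have : r <= 1 / 2.
      rewrite /r ler_pdivrMr ?mulr_gt0 ?ltr0n//; lra.
    lra.
  case/mapP=> l /(mem_binomial_split n l).2 /andP[ol _] ->.
  case: (ltngtP k l) => [kl|lk|kl].
  - by rewrite distrC (le_trans (far _ _ kl))// ler_norm.
  - by rewrite (le_trans (far _ _ lk))// ler_norm.
  - by move: ok; rewrite kl ol.
(* Since [1 / (4 * eps)] is below [n.+1], truncation costs at most a factor 2, well within the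
   allowed 16. *)
exists (2 ^- n).
  have : 2 `^ (- n.+1%:R) <= 2 `^ (- (1 / (4 * eps))) :> R.
    by apply: ler_powR; [rewrite ler1n | rewrite lerN2 ltW].
  rewrite powR_invn// exprS invfM.
  have : 0 <= 2 ^- n :> R by rewrite invr_ge0 exprn_ge0.
  set a := 2 ^- n; lra.
move=> j j0.
rewrite (moment_pair R mu)//; last by move=> x /mu_bound; lra.
rewrite (moment_pair R nu)//; last by move=> x /nu_bound; lra.
have avg_bound (s : seq R) : (0 < size s)%N ->
    (forall x, x \in s -> 0 <= x <= 1 / 2) ->
    0 <= (size s)%:R^-1 * \sum_(x <- s) x ^+ j <= 2 ^- j.
  move=> s0 sb; apply/andP; split.
    rewrite mulr_ge0 ?invr_ge0// big_seq sumr_ge0// => x /sb/andP[x0 _].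
    exact: exprn_ge0.
  rewrite mulrC ler_pdivrMr ?ltr0n// mulr_natr -iter_addr_0.
  rewrite -[in leRHS](count_predT s) -big_const_seq big_seq [leRHS]big_seq.
  apply: ler_sum => x /sb/andP[x0 x1].
  by rewrite -exprVn lerXn2r ?nnegrE// -div1r.
have := avg_bound _ mu0 mu_bound; have := avg_bound _ nu0 nu_bound.
have d0 : 0 <= 2 ^- n :> R by rewrite invr_ge0 exprn_ge0.
have [jn|nj] := ltnP j n.
  have -> : \sum_(x <- nu) x ^+ j = \sum_(x <- mu) x ^+ j.
    rewrite !big_map.
    under eq_bigr do rewrite expr_div_n.
    under [RHS]eq_bigr do rewrite expr_div_n.
    by rewrite -!mulr_suml binomial_power_sums.
  rewrite size_nu; set a := _ * _; move=> /andP[a0 _] _.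
  by have := mulr_ge0 d0 a0; lra.
(* Both averages now lie between 0 and [2 ^- n], so the moments differ by at most half of [2 ^- n],
   while the moment of [p1] is at least 1/2. *)
have : 2 ^- j <= 2 ^- n :> R.
  by rewrite lef_pV2 ?posrE ?exprn_gt0// ler_weXn2l// ler1n.
set a := _ * _; set b := _ * _ => jn /andP[b0 bj] /andP[a0 aj].
by have := mulr_ge0 d0 a0; lra.
Qed.
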